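(* Let $d\in\{2,3\}$, let $\mu>0$ be a constant, and let $\boldsymbol f\in[\mathcal P_N]^d$. Then there exists a vector polynomial $\boldsymbol g\in[\mathcal P_{N+4}]^d$ satisfying componentwise $\Delta^2\boldsymbol g=\boldsymbol f/\mu$ in $\mathbb R^d$, and for any such $\boldsymbol g$ the pair $$\boldsymbol u=\Delta\boldsymbol g-\nabla(\operatorname{div}\boldsymbol g),\qquad p=-\mu\Delta(\operatorname{div}\boldsymbol g)$$ belongs to $[\mathcal P_{N+2}]^d\times\mathcal P_{N+1}$ and solves the Stokes system $$\mu\Delta\boldsymbol u-\nabla p=\boldsymbol f,\qquad \operatorname{div}\boldsymbol u=0\quad\text{in }\mathbb R^d.$$
   Context: $\mathcal P_N$ denotes the space of all $d$-variate polynomials of total degree at most $N\in\mathbb N_0$. $\Delta$ acts componentwise on vector fields. $\mu$ is the dynamic viscosity. *)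

(* Defs.v *)
From HB Require Import structures.
From mathcomp Require Import all_boot all_order all_algebra.
From mathcomp Require mpoly.
Set Implicit Arguments.
Unset Strict Implicit.
Unset Printing Implicit Defensive.

(* The notations of mpoly clash with those of mathcomp-analysis, so mpoly is
   imported inside this section only. *)
Section PolynomialFunctions.
Import mpoly.
Local Open Scope ring_scope.

(* [msize q] is the total degree of [q] plus one, and 0 for [q = 0]. *)
Definition poly_space (R : comNzRingType) (d N : nat) (f : 'rV[R]_d -> R) :
    Prop :=
  exists q : {mpoly R[d]},
    (msize q <= N.+1)%N /\ (forall x, f x = q.@[fun i => x ord0 i]).

End PolynomialFunctions.

From mathcomp Require Import all_classical all_reals all_analysis.
Import Order.TTheory GRing.Theory Num.Theory.
Import numFieldNormedType.Exports.
Local Open Scope ring_scope.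

Section Fields.
Variables (R : realType) (d : nat).
Implicit Types (f : 'rV[R]_d -> R) (u : 'rV[R]_d -> 'rV[R]_d).

Definition component u (i : 'I_d) : 'rV[R]_d -> R := fun x => u x ord0 i.

Definition vpoly_space (N : nat) u : Prop :=
  forall i, poly_space N (component u i).

(* ['D_v f x] is a total function, meaningful where [f] is derivable along [v];
   it is only applied to polynomial functions here. *)
Definition partial (i : 'I_d) f : 'rV[R]_d -> R :=
  fun x => 'D_(delta_mx ord0 i) f x.

Definition grad f : 'rV[R]_d -> 'rV[R]_d := fun x => \row_i partial i f x.

Definition divergence u : 'rV[R]_d -> R :=
  fun x => \sum_(i < d) partial i (component u i) x.

Definition laplacian f : 'rV[R]_d -> R :=
  fun x => \sum_(i < d) partial i (partial i f) x.

Definition vlaplacian u : 'rV[R]_d -> 'rV[R]_d :=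
  fun x => \row_i laplacian (component u i) x.

Definition stokes (mu : R) (f u : 'rV[R]_d -> 'rV[R]_d) (p : 'rV[R]_d -> R) :
    Prop :=
  (forall x, mu *: vlaplacian u x - grad p x = f x) /\
  (forall x, divergence u x = 0).

End Fields.

(* Main.v *)
Require Import Defs.
From HB Require Import structures.
From mathcomp Require Import all_boot all_order all_algebra.
From mathcomp Require Import zify.
From mathcomp Require mpoly.
Set Implicit Arguments.
Unset Strict Implicit.
Unset Printing Implicit Defensive.

(** Everything is a computation with formal polynomials.  A field [u] in
    [vpoly_space n] is [vpeval G] for a family [G] of formal polynomials, and on
    such fields the analytic partial derivatives are the formal ones
    ([is_derive_peval]); so gradient, divergence and Laplacian become formal
    operators that commute with each other and lower degrees.

    For the second half, [div (Delta g - grad div g)] is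
    [Delta div g - Delta div g = 0], and the contribution [- mu Delta grad div g]
    of the velocity to the momentum equation is cancelled by the pressure
    gradient, leaving [mu Delta^2 g = f] ([mdivergence_velocity],
    [mstokes_momentum]).

    For the existence of [g], the Laplacian is shown to map polynomials of
    degree at most [n + 2] onto those of degree at most [n]
    ([mlap_onto_poly]), and this is used twice.  The reason is that, for a fixed
    variable [x_i], the Laplacian of the monomial [x_i^2 x^m] is a nonzero
    multiple of [x^m] plus multiples of monomials of the same total degree as
    [x^m], whose degree in the variables other than [x_i] is smaller by 2;
    induction on that degree solves the Laplace equation for every monomial ([mlap_ontoX]). *)

(** * Formal Laplacian *)

Section FormalLaplacian.
Import GRing.Theory Num.Theory.
Import mpoly.
Local Open Scope ring_scope.
Variables (R : numFieldType) (d : nat).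
Implicit Types (p q : {mpoly R[d]}) (m : 'X_{1..d}) (i j : 'I_d) (n : nat).

(** Polynomials are generated as a ring by constants and variables; facts about
    them that are stable under sums and products need no monomials. *)
Lemma mpoly_ring_ind (P : {mpoly R[d]} -> Prop) :
    (forall c, P c%:MP) -> (forall i, P 'X_i) ->
    (forall p q, P p -> P q -> P (p + q)) ->
    (forall p q, P p -> P q -> P (p * q)) ->
  forall p, P p.
Proof.
move=> PC PX PD PM; elim/mpolyind => [|c m p _ _ Pp]; first exact: (PC 0).
apply: PD Pp; rewrite -mul_mpolyC; apply: (PM _ _ (PC c)).
have P1 : P 1 by exact: (PC 1).
rewrite mpolyXE_id; apply: big_ind => [//||i _]; first exact: PM.
by elim: (m i) => [|k IHk]; rewrite ?expr0 // exprS; exact: PM.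
Qed.

Lemma mderivXU i j : ('X_j : {mpoly R[d]})^`M(i) = (j == i)%:R%:MP.
Proof.
rewrite mderivX mnm1E; case: eqVneq => [->|_]; last by rewrite scale0r.
by rewrite -[X in (X - _)%MM]add0m addmK mpolyX0 scale1r.
Qed.

Lemma msize_mderiv i p : (msize p^`M(i) <= (msize p).-1)%N.
Proof.
rewrite msizeE; apply/bigmax_leqP_seq => m.
rewrite mcoeff_msupp mcoeff_mderiv => nz _.
have : (m + U_(i))%MM \in msupp p.
  by rewrite mcoeff_msupp; apply: contraNneq nz => ->; rewrite mul0rn.
by move/msize_mdeg_lt; rewrite mdegD mdeg1 addn1; case: (msize p).
Qed.

Lemma msize_sum_le n (F : 'I_d -> {mpoly R[d]}) :
  (forall i, msize (F i) <= n)%N -> (msize (\sum_i F i) <= n)%N.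
Proof.
move=> leF; apply: (leq_trans (msize_sum _ _ _)).
exact/bigmax_leqP.
Qed.

Definition mlaplacian p := \sum_i p^`M(i)^`M(i).

Fact mlaplacian_is_linear : linear mlaplacian.
Proof.
move=> c p q; rewrite /mlaplacian scaler_sumr -big_split /=.
by apply: eq_bigr => i _; rewrite !linearP.
Qed.

HB.instance Definition _ := GRing.isLinear.Build R {mpoly R[d]} {mpoly R[d]}
  _ mlaplacian mlaplacian_is_linear.

Lemma mderiv_mlaplacian i p : (mlaplacian p)^`M(i) = mlaplacian p^`M(i).
Proof.
rewrite /mlaplacian raddf_sum /=; apply: eq_bigr => j _.
by rewrite (mderiv_comm j i p^`M(j)) (mderiv_comm j i p).
Qed.

Lemma msize_mlaplacian p : (msize (mlaplacian p) <= (msize p).-2)%N.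
Proof.
apply: msize_sum_le => i; apply: (leq_trans (msize_mderiv _ _)).
by rewrite -!subn1 leq_sub2r ?subn1 ?msize_mderiv.
Qed.

(** * Solving the Laplace equation for polynomials *)

Definition mlap_onto n p :=
  exists2 q, (msize q <= n)%N & mlaplacian q = p.

Lemma mlap_onto0 n : mlap_onto n 0.
Proof. by exists 0; rewrite ?msize0 // linear0. Qed.

Lemma mlap_ontoD n p q : mlap_onto n p -> mlap_onto n q -> mlap_onto n (p + q).
Proof.
move=> [p' szp <-] [q' szq <-]; exists (p' + q'); last by rewrite linearD.
by apply: (leq_trans (msizeD_le _ _)); rewrite geq_max szp.
Qed.

Lemma mlap_ontoZ n c p : mlap_onto n p -> mlap_onto n (c *: p).
Proof.
move=> [p' szp <-]; exists (c *: p'); last by rewrite linearZ.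
exact: leq_trans (msizeZ_le _ _) szp.
Qed.

Lemma mderiv2X i m :
  ('X_[m] : {mpoly R[d]})^`M(i)^`M(i)
    = (m i * (m i).-1)%:R *: 'X_[m - U_(i) *+ 2].
Proof.
rewrite !(mderivX, mderivZ) scalerA -natrM mnmBE mnm1E eqxx subn1.
by rewrite submDA mulmS mulm1n.
Qed.

(** Induction on the degree of [m] in the variables other than [i]: in the
    Laplacian of ['X_[m + 2 U_(i)]] the [i]-th term is a nonzero multiple of
    ['X_[m]], and each other term trades two powers of some variable [j] for two
    powers of the variable [i]. *)
Lemma mlap_ontoX i m : mlap_onto (mdeg m).+3 'X_[m].
Proof.
have [k] := ubnP (mdeg m - m i); elim: k m => // k IHk m le_k.
(* [c] is the factor produced by differentiating [X_i^(m i + 2)] twice. *)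
pose c : R := ((m i).+2 * (m i).+1)%:R.
have c_neq0 : c != 0 by rewrite pnatr_eq0.
pose M := (m + U_(i) *+ 2)%MM.
have ME j : M j = (m j + (i == j) * 2)%N by rewrite mnmDE mulmnE mnm1E mulnC.
have mdegM : mdeg M = (mdeg m).+2 by rewrite mdegD mdegMn mdeg1 mul1n addn2.
have -> : 'X_[m] = c^-1 *: (mlaplacian 'X_[M]
    + -1 *: \sum_(j | j != i) 'X_[M]^`M(j)^`M(j)) :> {mpoly R[d]}.
  rewrite /mlaplacian (bigD1 i) //= scaleN1r addrK mderiv2X scalerA ME eqxx.
  by rewrite mul1n addn2 mulVf // scale1r addmK.
apply/mlap_ontoZ/mlap_ontoD; first by exists 'X_[M]; rewrite ?msizeX ?mdegM.
apply/mlap_ontoZ; elim/big_ind: _ => [||j ji].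
- exact: mlap_onto0.
- exact: mlap_ontoD.
(* If [M j < 2], the truncated [M - 2 U_(j)] is not of degree [mdeg m], but the
   coefficient in front of it vanishes. *)
rewrite mderiv2X; have [small|large] := leqP (M j) 1.
  suff -> : (M j * (M j).-1)%N = 0%N by rewrite scale0r; exact: mlap_onto0.
  by case: (M j) small => [|[]].
have le2M : (U_(j) *+ 2 <= M)%MM.
  apply/mnm_lepP => l; rewrite mulmnE mnm1E.
  by case: eqVneq => [<-|_]; rewrite ?mul1n ?mul0n.
have deg_eq : mdeg (M - U_(j) *+ 2) = mdeg m.
  have := congr1 (@mdeg d) (submK le2M).
  by rewrite mdegD mdegMn mdeg1 mdegM; lia.
rewrite -deg_eq; apply/mlap_ontoZ/IHk.
(* The measure decreases because [m i] grows by 2 and stays at most [mdeg m]. *)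
rewrite deg_eq mnmBE mulmnE mnm1E (negPf ji) ME eqxx.
have : (M j + m i <= mdeg m + (i == j) * 2)%N.
  rewrite ME (eq_sym i j) (negPf ji) mul0n !addn0 mdegE (bigD1 i) //=.
  by rewrite addnC leq_add2l (bigD1 j) //= leq_addr.
move: large; rewrite ME (eq_sym i j) (negPf ji); lia.
Qed.

Lemma mlap_onto_poly i n p : (msize p <= n)%N -> mlap_onto n.+2 p.
Proof.
move=> szp; rewrite [p]mpolyE big_seq; elim/big_ind: _ => [||m /msize_mdeg_lt lt].
- exact: mlap_onto0.
- exact: mlap_ontoD.
apply: mlap_ontoZ; have [q szq <-] := mlap_ontoX i m; exists q => //.
by apply: leq_trans szq _; rewrite !ltnS (leq_trans lt).
Qed.

(** * The formal Stokes identities *)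

Definition mdivergence (G : 'I_d -> {mpoly R[d]}) := \sum_i (G i)^`M(i).

Lemma msize_mdivergence n G :
  (forall i, msize (G i) <= n)%N -> (msize (mdivergence G) <= n.-1)%N.
Proof.
move=> szG; apply: msize_sum_le => i; apply: (leq_trans (msize_mderiv _ _)).
by rewrite -!subn1 leq_sub2r.
Qed.

Definition mstokes_velocity (G : 'I_d -> {mpoly R[d]}) i :=
  mlaplacian (G i) - (mdivergence G)^`M(i).

(** [div Delta] and [Delta div] agree, and [div grad] is the Laplacian. *)
Lemma mdivergence_velocity G : mdivergence (mstokes_velocity G) = 0.
Proof.
rewrite /mdivergence /mstokes_velocity.
under eq_bigr => i _ do rewrite mderivB mderiv_mlaplacian.
by rewrite sumrB -linear_sum subrr.
Qed.

(** The second summand is [- (1 / mu)] times the gradient of the pressure; it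
    cancels the Laplacian of the gradient part of the velocity. *)
Lemma mstokes_momentum G i :
  mlaplacian (mstokes_velocity G i) + (mlaplacian (mdivergence G))^`M(i)
    = mlaplacian (mlaplacian (G i)).
Proof. by rewrite /mstokes_velocity linearB mderiv_mlaplacian subrK. Qed.

Lemma msize_velocity n G i :
  (forall j, msize (G j) <= n.+2)%N -> (msize (mstokes_velocity G i) <= n)%N.
Proof.
move=> szG; apply: (leq_trans (msizeD_le _ _)); rewrite geq_max msizeN.
have := msize_mlaplacian (G i); have := msize_mderiv i (mdivergence G).
have := msize_mdivergence szG; move: (szG i); move: (msize _) => a; lia.
Qed.

Definition peval p : 'rV[R]_d -> R := fun x => p.@[fun i => x ord0 i].

Lemma poly_spaceP n (f : 'rV[R]_d -> R) :
  poly_space n f <-> exists2 p, (msize p <= n.+1)%N & forall x, f x = peval p x.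
Proof. by split=> [[p []]|[p]]; exists p. Qed.

End FormalLaplacian.

From mathcomp Require Import all_classical all_reals all_analysis.
Import Order.TTheory GRing.Theory Num.Theory.
Import numFieldNormedType.Exports.
Local Open Scope ring_scope.

(** * Polynomial fields and their derivatives *)

Section PolynomialFields.
(* Only the canonical structures and names are imported: the notations of
   multivariate polynomials clash with those of topology. *)
Import -(notations) mpoly.
Variables (R : realType) (d : nat).
Local Notation mpolyR := (mpoly d R).
Local Notation msize := (mmeasure (@mdeg d)).
Implicit Types (p q : mpolyR) (G : 'I_d -> mpolyR) (x : 'rV[R]_d) (i j : 'I_d).
Implicit Types (u f : 'rV[R]_d -> 'rV[R]_d) (n : nat).

Lemma is_derive_coord j x (v : 'rV[R]_d) :
  is_derive x v (fun y : 'rV[R]_d => y ord0 j : R) (v ord0 j).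
Proof.
have dif := @differentiable_coord R 1 d x ord0 j.
apply: DeriveDef; first exact: diff_derivable.
rewrite deriveE //.
have @f : {linear 'rV[R]_d -> R}.
  exists (fun y : 'rV[R]_d => y ord0 j); do 2![eexists]; do ?[constructor];
    by rewrite ?mxE// => ? *; rewrite ?mxE//; move=> ?; rewrite !mxE.
rewrite (_ : (fun _ => _) = f) // diff_lin //; exact: coord_continuous.
Qed.

(** Both sides are derivations in [p], so it is enough to compare them on
    constants and variables. *)
Lemma is_derive_peval i p x :
  is_derive x (delta_mx ord0 i) (peval p) (peval (mderiv i p) x).
Proof.
elim/mpoly_ring_ind: p x => [c|j|p q Dp Dq|p q Dp Dq] x.
- rewrite mderivC /peval meval0.
  have -> : (fun y : 'rV[R]_d => meval (fun i => y ord0 i)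
      (mpolyC d c)) = cst c.
    by apply/funext => y; rewrite mevalC.
  exact: is_derive_cst.
- have -> : peval (mpolyX R (mnm1 j)) = fun y => y ord0 j.
    by apply/funext => y; rewrite /peval mevalXU.
  apply: is_derive_eq (is_derive_coord _ _ _) _.
  by rewrite mderivXU /peval mevalC mxE eqxx.
- have -> : peval (p + q) = peval p + peval q.
    by apply/funext => y; rewrite /peval mevalD.
  by apply: is_derive_eq; rewrite mderivD /peval mevalD.
- have -> : peval (p * q) = peval p * peval q.
    by apply/funext => y; rewrite /peval mevalM.
  apply: is_derive_eq; rewrite mderivM /peval mevalD !mevalM.
  by rewrite addrC mulrC.
Qed.

Lemma partial_peval i p : partial i (peval p) = peval (mderiv i p).
Proof. by apply/funext => x; have := is_derive_peval i p x; case. Qed.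

Lemma peval_sum (F : 'I_d -> mpolyR) x :
  peval (\sum_i F i) x = \sum_i peval (F i) x.
Proof. by rewrite /peval raddf_sum. Qed.

Lemma laplacian_peval p : laplacian (peval p) = peval (mlaplacian p).
Proof.
apply/funext => x; rewrite peval_sum.
by apply: eq_bigr => i _; rewrite !partial_peval.
Qed.

Definition vpeval G : 'rV[R]_d -> 'rV[R]_d := fun x => \row_i peval (G i) x.

Lemma component_vpeval G i : component (vpeval G) i = peval (G i).
Proof. by apply/funext => x; rewrite /component mxE. Qed.

Lemma vlaplacian_vpeval G :
  vlaplacian (vpeval G) = vpeval (fun i => mlaplacian (G i)).
Proof.
apply/funext => x; apply/rowP => i.
by rewrite !mxE component_vpeval laplacian_peval.
Qed.

Lemma divergence_vpeval G : divergence (vpeval G) = peval (mdivergence G).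
Proof.
apply/funext => x; rewrite peval_sum.
by apply: eq_bigr => i _; rewrite component_vpeval partial_peval.
Qed.

Lemma grad_peval p : grad (peval p) = vpeval (fun i => mderiv i p).
Proof. by apply/funext => x; apply/rowP => i; rewrite !mxE partial_peval. Qed.

Lemma vpoly_spaceP n u :
  vpoly_space n u <->
    exists2 G, (forall i, msize (G i) <= n.+1)%N & u = vpeval G.
Proof.
split=> [Pu|[G szG ->] i]; last first.
  by apply/poly_spaceP; exists (G i) => // x; rewrite component_vpeval.
have /choice[G GP] i : exists p,
    (msize p <= n.+1)%N /\ forall x, component u i x = peval p x.
  by have /poly_spaceP[p] := Pu i; exists p.
exists G => [i|]; first by case: (GP i).
by apply/funext => x; apply/rowP => i; rewrite mxE -(GP i).2.
Qed.

(** * Transfer to the Stokes system *)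

Lemma vpeval_velocity G :
  (fun x => vlaplacian (vpeval G) x - grad (divergence (vpeval G)) x)
    = vpeval (mstokes_velocity G).
Proof.
apply/funext => x; rewrite vlaplacian_vpeval divergence_vpeval grad_peval.
by apply/rowP => i; rewrite !mxE /peval mevalB.
Qed.

Lemma vpeval_pressure mu G :
  (fun x => - mu * laplacian (divergence (vpeval G)) x)
    = peval (- mu *: mlaplacian (mdivergence G)).
Proof.
by apply/funext => x; rewrite divergence_vpeval laplacian_peval /peval
  mevalZ.
Qed.

(** The right-hand side is written as [mu Delta^2 g], so that the identity holds
    for every polynomial field [g]. *)
Lemma stokes_velocity_pressure mu G :
  stokes mu (fun x => mu *: vlaplacian (vlaplacian (vpeval G)) x)
    (vpeval (mstokes_velocity G))
    (peval (- mu *: mlaplacian (mdivergence G))).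
Proof.
split=> x; last first.
  by rewrite divergence_vpeval mdivergence_velocity /peval meval0.
apply/rowP => i; rewrite !vlaplacian_vpeval grad_peval !mxE /peval.
rewrite mderivZ mevalZ mulNr opprK -mulrDr -mevalD.
by rewrite mstokes_momentum.
Qed.

Lemma vpoly_spaceZ n c u :
  vpoly_space n u -> vpoly_space n (fun x => c *: u x).
Proof.
move=> /vpoly_spaceP[G szG ->]; apply/vpoly_spaceP; exists (fun i => c *: G i).
  by move=> i; apply: leq_trans (msizeZ_le _ _) (szG i).
by apply/funext => x; apply/rowP => i; rewrite !mxE /peval mevalZ.
Qed.

Lemma vlaplacian_onto n f : (0 < d)%N -> vpoly_space n f ->
  exists2 g, vpoly_space n.+2 g & vlaplacian g = f.
Proof.
move=> d_gt0 /vpoly_spaceP[F szF ->].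
have /choice[G GP] j : exists q, (msize q <= n.+3)%N /\ mlaplacian q = F j.
  by have [q] := mlap_onto_poly (Ordinal d_gt0) (szF j); exists q.
exists (vpeval G); first by apply/vpoly_spaceP; exists G => // j; case: (GP j).
rewrite vlaplacian_vpeval; congr vpeval.
by apply/funext => j; case: (GP j).
Qed.

Lemma vpoly_space_velocity n G : (forall j, msize (G j) <= n.+3)%N ->
  vpoly_space n (vpeval (mstokes_velocity G)).
Proof.
move=> szG; apply/vpoly_spaceP; exists (mstokes_velocity G) => // i.
exact: msize_velocity.
Qed.

Lemma poly_space_pressure n mu G : (forall j, msize (G j) <= n.+4)%N ->
  poly_space n (peval (- mu *: mlaplacian (mdivergence G))).
Proof.
move=> szG; apply/poly_spaceP; exists (- mu *: mlaplacian (mdivergence G)) => //.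
apply: leq_trans (msizeZ_le _ _) _; apply: leq_trans (msize_mlaplacian _) _.
by rewrite -subn2 leq_subLR; exact: (msize_mdivergence szG).
Qed.

End PolynomialFields.

Theorem mainTheorem6 (R : realType) (d N : nat) (mu : R)
    (f : 'rV[R]_d -> 'rV[R]_d)
    (hd : d = 2%N \/ d = 3%N) (hmu : 0 < mu) (hf : vpoly_space N f) :
  (exists g : 'rV[R]_d -> 'rV[R]_d,
     vpoly_space (N + 4) g /\
     (forall x, vlaplacian (vlaplacian g) x = mu^-1 *: f x)) /\
  (forall g : 'rV[R]_d -> 'rV[R]_d,
     vpoly_space (N + 4) g ->
     (forall x, vlaplacian (vlaplacian g) x = mu^-1 *: f x) ->
     let u : 'rV[R]_d -> 'rV[R]_d :=
       fun x => vlaplacian g x - grad (divergence g) x in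
     let p : 'rV[R]_d -> R :=
       fun x => - mu * laplacian (divergence g) x in
     [/\ vpoly_space (N + 2) u, poly_space (N + 1) p & stokes mu f u p]).
Proof.
split=> [|g /vpoly_spaceP[G szG ->] biharmonic u p].
  have d_gt0 : (0 < d)%N by case: hd => ->.
  have [h hP hE] := vlaplacian_onto d_gt0 (vpoly_spaceZ mu^-1 hf).
  have [g gP gE] := vlaplacian_onto d_gt0 hP.
  by exists g; rewrite addn4 gE hE; split.
rewrite addn4 in szG; rewrite /u /p vpeval_velocity vpeval_pressure; split.
- by rewrite addn2; exact: vpoly_space_velocity.
- by rewrite addn1; exact: poly_space_pressure.
have -> : f = (fun x => mu *: vlaplacian (vlaplacian (vpeval G)) x).
  by apply/funext => x; rewrite biharmonic scalerA divff ?scale1r // gt_eqF.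
exact: stokes_velocity_pressure.
Qed.
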